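(* Let \(G\) be a bipartite graph with fixed parts \(A\) and \(B\). Then the following statements are equivalent: (i) Either \(G\) is nonempty, or \(G\) is empty but at least one of the parts \(A\), \(B\) is infinite. (ii) \(G\) is farthest for some metric space. (iii) \(G\) is farthest for some semimetric space.
   Context: All graphs are simple. A bipartite graph with fixed parts \(A\), \(B\) has vertex set \(A\cup B\), \(A,B\) nonempty disjoint, each edge joining \(A\) and \(B\); it is empty if it has no edges. A semimetric on a nonempty set \(X\) is a function \(d\colon X\times X\to[0,\infty)\) with \(d(x,y)=d(y,x)\) and \(d(x,y)=0\iff x=y\). A bipartite graph \(G\) with parts \(A\), \(B\) is farthest for the semimetric space \((X,d)\) if \(A\), \(B\) are disjoint subsets of \(X\) and, for all \(a\in A\), \(b\in B\), \(\{a,b\}\in E(G)\) iff \(d(a,b)=\sup\{d(x,y)\colon x\in A,y\in B\}\). *)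

(* Defs.v *)
From HB Require Import structures.
From mathcomp Require Import all_boot all_order all_algebra.
From mathcomp Require Import boolp classical_sets functions cardinality.
From mathcomp Require Import reals ereal topology.

Set Implicit Arguments.
Unset Strict Implicit.
Unset Printing Implicit Defensive.

Import Order.TTheory GRing.Theory Num.Theory.

Local Open Scope classical_set_scope.
Local Open Scope ring_scope.

(* The vertex set is [partA `|` partB]; elements of [T] outside of it are not
   vertices. Loops are excluded by [adj_parts] and [parts_disjoint]. *)
Record bigraph (T : Type) := Bigraph {
  partA : set T;
  partB : set T;
  adj : T -> T -> Prop;
  partA_neq0 : partA !=set0;
  partB_neq0 : partB !=set0;
  parts_disjoint : partA `&` partB = set0;
  adj_sym : forall x y, adj x y -> adj y x;
  adj_parts : forall x y, adj x y ->
    (partA x /\ partB y) \/ (partB x /\ partA y)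
}.

Definition vertices (T : Type) (G : bigraph T) : set T := partA G `|` partB G.

Definition empty_bigraph (T : Type) (G : bigraph T) : Prop :=
  forall x y, ~ adj G x y.

Record semimetricSpace (R : realType) := SemimetricSpace {
  smcarrier :> Type;
  smcarrier_inhabited : inhabited smcarrier;
  smdist : smcarrier -> smcarrier -> R;
  smdist_ge0 : forall x y, 0 <= smdist x y;
  smdist_sym : forall x y, smdist x y = smdist y x;
  smdist_eq0 : forall x y, smdist x y = 0 <-> x = y
}.

(* The vertices of [G] are regarded as points of [X] through [i], which is
   injective on them; so the images of the parts are disjoint subsets of [X].
   The supremum is taken in the extended reals: when the distances between the
   parts are unbounded it is [+oo], and is attained by no pair. *)
Definition farthest (R : realType) (T X : Type) (G : bigraph T)
    (d : X -> X -> R) (i : T -> X) : Prop :=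
  set_inj (vertices G) i /\
  forall a b, partA G a -> partB G b ->
    (adj G a b <->
     (d (i a) (i b))%:E =
       ereal_sup [set (d (i x) (i y))%:E | x in partA G & y in partB G]).

(* A nonempty [X] need not be required: it contains the images of the parts. *)
Definition farthest_for_metric (R : realType) (T : Type) (G : bigraph T) :=
  exists (X : metricType R) (i : T -> X), farthest G (@mdist R X) i.

Definition farthest_for_semimetric (R : realType) (T : Type) (G : bigraph T) :=
  exists (X : semimetricSpace R) (i : T -> X), farthest G (@smdist R X) i.

(* Main.v *)
Require Import Defs.
From HB Require Import structures.
From mathcomp Require Import all_boot all_order all_algebra.
From mathcomp Require Import boolp classical_sets functions cardinality.
From mathcomp Require Import reals ereal topology.

(** The condition of being farthest says that the adjacent pairs are exactly
    the maximizers of the distance on A x B. On finite parts a maximizer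
    exists, so an empty graph on finite parts is not farthest. Conversely, a
    nonempty graph is farthest for the metric with value 2 on adjacent pairs
    and 1 on the other pairs of distinct points. If a part is infinite, there
    is a map w from the points onto the natural numbers, already surjective on
    that part, and the metric (w x + 1) + (w y + 1) for x <> y has no maximizer
    on A x B. *)

Set Implicit Arguments.
Unset Strict Implicit.
Unset Printing Implicit Defensive.

Import Order.TTheory GRing.Theory Num.Theory.

Local Open Scope classical_set_scope.
Local Open Scope ring_scope.

(** A member of a set is its supremum exactly when it bounds the set. This reduces [farthest] to
    inequalities between reals. *)
Lemma eq_ereal_sup_image2P (R : realType) (S U : Type) (A : set S) (B : set U)
    (f : S -> U -> R) (a : S) (b : U) : A a -> B b ->
  (f a b)%:E = ereal_sup [set (f x y)%:E | x in A & y in B] <->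
  (forall x y, A x -> B y -> f x y <= f a b).
Proof.
move=> Aa Bb; split=> [E x y Ax By|le_fab].
  by rewrite -lee_fin E; apply: ereal_sup_ubound; exists x => //; exists y.
apply/eqP; rewrite eq_le; apply/andP; split.
  by apply: ereal_sup_ubound; exists a => //; exists b.
by apply: ge_ereal_sup => _ [x Ax [y By <-]]; rewrite lee_fin le_fab.
Qed.

Lemma finite_set_max (R : realType) (D : set R) :
  finite_set D -> D !=set0 -> exists m, D m /\ forall z, D z -> z <= m.
Proof.
move=> /finite_seqP[s ->] [z]; elim: s z => [//|z [_ _ _|t s IH _ _]].
  by exists z; split=> [|u]; rewrite /= inE// => /eqP ->.
have [m [ms m_max]] := IH t (mem_head _ _).
have [le_zm|lt_mz] := leP z m.
  exists m; split=> [|u]; first by rewrite /= inE [m \in _]ms orbT.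
  by rewrite /= inE => /orP[/eqP -> //|/m_max].
exists z; split=> [|u]; first by rewrite /= mem_head.
rewrite /= inE => /orP[/eqP -> //|/m_max le_um].
exact: le_trans le_um (ltW lt_mz).
Qed.

Lemma finite_set_max2 (R : realType) (S U : Type) (A : set S) (B : set U)
    (f : S -> U -> R) :
  finite_set A -> finite_set B -> A !=set0 -> B !=set0 ->
  exists a b, [/\ A a, B b & forall x y, A x -> B y -> f x y <= f a b].
Proof.
move=> finA finB [a Aa] [b Bb].
have D0 : [set f x y | x in A & y in B] !=set0.
  by exists (f a b), a => //; exists b.
have [_ [[c Ac [e Be <-]] max_ce]] :=
  finite_set_max (finite_image2 f finA finB) D0.
exists c, e; split=> // x y Ax By.
by apply: max_ce; exists x => //; exists y.
Qed.

Section MetricOfDist.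
Variables (R : realType) (T : Type) (d : T -> T -> R).
Hypotheses (dxx : forall x, d x x = 0) (d_eq0 : forall x y, d x y = 0 -> x = y).
Hypotheses (d_sym : forall x y, d x y = d y x).
Hypothesis d_triangle : forall y x z, d x z <= d x y + d y z.

(** A [metricType] carries a choice structure; on the bare type [T] it comes from classical
    axioms. *)
Let C : choiceType := HB.pack T (gen_eqMixin T) (gen_choiceMixin T).
Let M : metricType R :=
  HB.pack T C (isMetric.Build R C dxx d_eq0 d_sym d_triangle).

Lemma metricType_of_dist : exists (X : metricType R) (i : T -> X),
  injective i /\ forall x y, mdist (i x) (i y) = d x y.
Proof. by exists M; exists id; split=> [x y|x y]. Qed.

End MetricOfDist.

(** Resetting [e] to 0 on the diagonal gives a metric: the triangle inequality survives, being
    trivial when two of the points coincide. *)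
Lemma farthest_for_metric_offdiag (R : realType) (T : Type) (G : bigraph T)
    (e : T -> T -> R) :
  (forall x y, 0 < e x y) -> (forall x y, e x y = e y x) ->
  (forall y x z, e x z <= e x y + e y z) ->
  (forall a b, partA G a -> partB G b ->
    adj G a b <-> forall x y, partA G x -> partB G y -> e x y <= e a b) ->
  farthest_for_metric R G.
Proof.
move=> e_gt0 e_sym e_tri eG.
pose d x y := if `[< x = y >] then 0 else e x y.
have dxx x : d x x = 0 by rewrite /d asboolT.
have dN x y : x <> y -> d x y = e x y by move=> xy; rewrite /d asboolF.
have d_eq0 x y : d x y = 0 -> x = y.
  by rewrite /d; case: asboolP => // _ /eqP; rewrite gt_eqF.
have d_sym x y : d x y = d y x.
  by have [->//|xy] := pselect (x = y); rewrite !dN// => /esym.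
have d_ge0 x y : 0 <= d x y by rewrite /d; case: asboolP => // _; exact: ltW.
have d_tri y x z : d x z <= d x y + d y z.
  have [->|xz] := pselect (x = z); first by rewrite dxx addr_ge0.
  have [->|xy] := pselect (x = y); first by rewrite dxx add0r.
  have [->|yz] := pselect (y = z); first by rewrite dxx addr0.
  by rewrite !dN.
have [X [i [i_inj iE]]] := metricType_of_dist dxx d_eq0 d_sym d_tri.
exists X, i; split=> [x y _ _|a b Aa Bb]; first exact: i_inj.
(* The parts are disjoint, so the reset diagonal never meets A x B. *)
have AB x y : partA G x -> partB G y -> d x y = e x y.
  move=> Ax By; apply: dN => xy; subst y.
  by have : (partA G `&` partB G) x by []; rewrite parts_disjoint.
rewrite (eq_ereal_sup_image2P (fun x y => mdist (i x) (i y)) Aa Bb) eG//.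
by split=> H x y Ax By; have := H x y Ax By; rewrite !iE !AB.
Qed.

Lemma nonempty_farthest_for_metric (R : realType) (T : Type) (G : bigraph T) :
  ~ empty_bigraph G -> farthest_for_metric R G.
Proof.
move=> /existsNP[u /existsNP[v /contrapT uv]].
have [p [q [Ap Bq pq]]] : exists p q, [/\ partA G p, partB G q & adj G p q].
  have [[Au Bv]|[Bu Av]] := adj_parts uv; first by exists u, v.
  by exists v, u; split=> //; exact: adj_sym.
have le12 : (1 : R) <= 2 by rewrite ler1n.
(* Values between 1 and 2 satisfy the triangle inequality, as 2 = 1 + 1. *)
pose e x y : R := if `[< adj G x y >] then 2 else 1.
have e_ge1 x y : 1 <= e x y by rewrite /e; case: asboolP.
have e_le2 x y : e x y <= 2 by rewrite /e; case: asboolP.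
apply: (@farthest_for_metric_offdiag _ _ _ e) => [x y|x y|y x z|a b Aa Bb].
- exact: lt_le_trans (e_ge1 x y).
- congr (if _ then _ else _); apply: asbool_equiv_eq.
  by split; exact: adj_sym.
- exact: le_trans (lerD (e_ge1 x y) (e_ge1 y z)).
(* The edge [p], [q] has value 2, so a maximizing pair has value 2 as well and is an edge. *)
- split=> [ab x y _ _|/(_ _ _ Ap Bq)].
    by rewrite [leRHS]/e asboolT.
  by rewrite /e (asboolT pq); case: asboolP => // _; rewrite lern1.
Qed.

Lemma infinite_set_surj_nat (T : Type) (A : set T) :
  infinite_set A -> exists w : T -> nat, forall n, exists2 a, A a & w a = n.
Proof.
move=> /infiniteP/pcard_surjP[w w_surj]; exists w => n.
exact: w_surj.
Qed.

Lemma infinite_farthest_for_metric (R : realType) (T : Type) (G : bigraph T) :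
  empty_bigraph G -> infinite_set (partA G) \/ infinite_set (partB G) ->
  farthest_for_metric R G.
Proof.
move=> G0 infG.
have [w w_unbounded] : exists w : T -> nat,
    (forall n, exists2 a, partA G a & w a = n) \/
    (forall n, exists2 b, partB G b & w b = n).
  by case: infG => /infinite_set_surj_nat[w ws]; exists w; [left|right].
(* The successors keep [e] positive where [w] vanishes. *)
pose e x y : R := (w x).+1%:R + (w y).+1%:R.
apply: (@farthest_for_metric_offdiag _ _ _ e) => [x y|x y|y x z|a b Aa Bb].
- by rewrite addr_gt0.
- exact: addrC.
- by rewrite /e -!natrD ler_nat leq_add// ?leq_addr ?leq_addl.
- split=> [/G0//|e_max]; exfalso.
  (* Replacing the endpoint in the infinite part by one whose [w] is larger by 1 beats the supposed
     maximum. *)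
  case: w_unbounded => [/(_ (w a).+1)[x Ax wx]|/(_ (w b).+1)[y By wy]].
    by have := e_max x b Ax Bb; rewrite /e lerD2r ler_nat wx ltnn.
  by have := e_max a y Aa By; rewrite /e lerD2l ler_nat wy ltnn.
Qed.

(** On finite parts some pair attains the maximum and is therefore an edge. Any real function [d] is
    allowed, which covers metrics and semimetrics at once. *)
Lemma farthest_nonempty_or_infinite (R : realType) (T X : Type)
    (G : bigraph T) (d : X -> X -> R) (i : T -> X) :
  farthest G d i ->
  ~ empty_bigraph G \/
  (empty_bigraph G /\ (infinite_set (partA G) \/ infinite_set (partB G))).
Proof.
move=> [_ dG]; have [G0|] := pselect (empty_bigraph G); last by left.
right; split=> //; apply: contrapT => /not_orP[/contrapT finA /contrapT finB].
have [a [b [Aa Bb max_ab]]] := finite_set_max2 (fun x y => d (i x) (i y))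
  finA finB (partA_neq0 G) (partB_neq0 G).
apply: (G0 a b); apply/(dG a b Aa Bb).
exact/(eq_ereal_sup_image2P (fun x y => d (i x) (i y)) Aa Bb).
Qed.

Lemma farthest_for_metric_semimetric (R : realType) (T : Type) (G : bigraph T) :
  farthest_for_metric R G -> farthest_for_semimetric R G.
Proof.
move=> [X [i dG]].
(* The image of a vertex shows that the carrier is inhabited. *)
have [a _] := partA_neq0 G.
have X_eq0 (x y : X) : mdist x y = 0 <-> x = y.
  by split=> [/mdist_positivity|->]; last exact: mdistxx.
by exists (SemimetricSpace (inhabits (i a)) (@mdist_ge0 R X)
  (@metric_sym R X) X_eq0), i.
Qed.

Theorem theorem4p2 (R : realType) (T : Type) (G : bigraph T) :
  ((~ empty_bigraph G \/
    (empty_bigraph G /\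
     (infinite_set (partA G) \/ infinite_set (partB G))))
   <-> farthest_for_metric R G) /\
  (farthest_for_metric R G <-> farthest_for_semimetric R G).
Proof.
have i_ii : ~ empty_bigraph G \/
    (empty_bigraph G /\ (infinite_set (partA G) \/ infinite_set (partB G))) ->
    farthest_for_metric R G.
  move=> [|[]]; first exact: nonempty_farthest_for_metric.
  exact: infinite_farthest_for_metric.
split; split=> //.
- by move=> [X [i /farthest_nonempty_or_infinite]].
- exact: farthest_for_metric_semimetric.
(* The given semimetric is discarded: it yields the condition on [G], from which a metric is built
   afresh. *)
- by move=> [X [i /farthest_nonempty_or_infinite/i_ii]].
Qed.
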